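(* Let $D$ be a depth function on $\mathbb{R}^d$ with values in $[0,1]$. Suppose that for any distribution $P$ on $\mathbb{R}^d$ whose mass does not escape to infinity, the $\beta$-local depth satisfies $LD^\beta(\mathbf{x}\mid P)\to0$ as $\|\mathbf{x}\|\to\infty$ for all $\beta\in(0,1]$. Then, for any such $P$, the integrated local depth satisfies $ILD^B(\mathbf{x}\mid P)\to0$ as $\|\mathbf{x}\|\to\infty$ for any $B\in(0,1]$.
   Context: ''Mass does not escape to infinity'' means $P(\{\mathbf{y}:\|\mathbf{y}\|>r\})\to0$ as $r\to\infty$. A depth function is a map $D(\cdot\mid P):\mathbb{R}^d\to[0,1]$ defined for every probability distribution $P$ on $\mathbb{R}^d$, measuring the centrality of points with respect to $P$. Write $P_{\mathbf{X}}$ for the distribution of a random vector $\mathbf{X}$. Central regions: for a distribution $Q$ and $\alpha\in(0,1]$, $R_\alpha(Q)=\{\mathbf{z}:D(\mathbf{z}\mid Q)\ge\alpha\}$; for $\beta\in(0,1]$, $R^\beta(Q)=\bigcap_{\alpha\in A(\beta)}R_\alpha(Q)$ with $A(\beta)=\{\alpha: Q(R_\alpha(Q))\ge\beta\}$ (empty intersection $=\mathbb{R}^d$). $\beta$-local depth: for $\mathbf{X}\sim P$, let $R^\beta_{\mathbf{x}}=R^\beta\big(\tfrac12P_{\mathbf{X}}+\tfrac12P_{2\mathbf{x}-\mathbf{X}}\big)$ and let $P^\beta_{\mathbf{x}}$ be $P$ conditioned on $R^\beta_{\mathbf{x}}$. Then $LD^\beta(\mathbf{x}\mid P)=D(\mathbf{x}\mid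 P^\beta_{\mathbf{x}})$, assumed measurable in $\beta$ so that the integral below is defined. Integrated local depth at level $B\in(0,1]$: $ILD^B(\mathbf{x}\mid P)=\int_0^BLD^\beta(\mathbf{x}\mid P)\,dW(\beta)$, where $W$ is a fixed (not depending on $\mathbf{x}$) probability measure with $W((0,B])=1$, absolutely continuous with respect to Lebesgue measure with a bounded measurable density. *)

(* Defs.v *)
From HB Require Import structures.
From mathcomp Require Import all_boot all_order all_algebra.
From mathcomp Require Import all_classical all_reals all_analysis.

Set Implicit Arguments.
Unset Strict Implicit.
Unset Printing Implicit Defensive.

Import Order.TTheory GRing.Theory Num.Theory.
Import numFieldNormedType.Exports.

Local Open Scope classical_set_scope.
Local Open Scope ring_scope.

(* The library puts no sigma-algebra on matrices: this is the Borel one. *)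
HB.instance Definition _ (R : realType) (d : nat) :=
  @isMeasurable.Build (sigma_display (@open 'rV[R]_d)) 'rV[R]_d
    <<s @open 'rV[R]_d >> (@sigma_algebra0 _ setT _) (@sigma_algebraC _ _)
    (@sigma_algebra_bigcup _ setT _).

(* The Euclidean norm; the library's `|x| on 'rV[R]_d is the sup norm. *)
Definition enorm (R : realType) (d : nat) (x : 'rV[R]_d) : R :=
  Num.sqrt (\sum_(i < d) x ord0 i ^+ 2).

Definition at_infty (R : realType) (d : nat) : set_system 'rV[R]_d :=
  [set S | exists r : R, forall x, r < enorm x -> S x].

Global Instance at_infty_filter (R : realType) (d : nat) :
  Filter (@at_infty R d).
Proof.
constructor=> [|S T [r rS] [s sT]|S T ST [r rS]]; first by exists 0.
- exists (Num.max r s) => x; rewrite gt_max => /andP[rx sx].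
  by split; [exact: rS|exact: sT].
- by exists r => x /rS/ST.
Qed.

Section local_depth.
Context {R : realType} {d : nat}.
Local Notation V := 'rV[R]_d.
Local Notation law := (probability V R).

Definition mass_does_not_escape (P : law) : Prop :=
  P [set y | r < enorm y] @[r --> +oo] --> 0%E.

(* A [probability] also carries values on non-measurable sets; [depth_ext] says
   that D depends on the distribution only. *)
Record is_depth (D : law -> V -> R) : Prop := IsDepth {
  depth_ext : forall P Q : law,
    (forall A, measurable A -> P A = Q A) -> D P =1 D Q;
  depth_itv : forall P z, 0 <= D P z <= 1 }.

Definition reflection (x : V) (y : V) : V := 2 *: x - y.

Lemma measurable_reflection (x : V) : measurable_fun setT (reflection x).
Proof.
have cf : continuous (reflection x).
  move=> y; apply: (@continuousB _ _ _ (cst _) id); first exact: cst_continuous.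
  exact: cvg_id.
apply: (@measurability _ _ _ _ _ _ (@open V)) => // _ [B oB <-].
by rewrite setTI; apply: sub_sigma_algebra; exact: open_comp.
Qed.

HB.instance Definition _ (x : V) :=
  isMeasurableFun.Build _ _ _ _ (reflection x) (measurable_reflection x).

Section half_mixture.
Variables P Q : law.

Definition half_mixture : set V -> \bar R :=
  measure_add (mscale (2^-1)%:nng P) (mscale (2^-1)%:nng Q).

HB.instance Definition _ := Measure.on half_mixture.

Lemma half_mixture_setT : half_mixture setT = 1%E.
Proof.
rewrite /half_mixture measure_addE/= /mscale/= !probability_setT !mule1.
by rewrite -EFinD; congr EFin; rewrite [RHS]splitr mul1r.
Qed.

HB.instance Definition _ :=
  Measure_isProbability.Build _ _ _ half_mixture half_mixture_setT.

End half_mixture.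

(* 1/2 P_X + 1/2 P_{2x-X} for X ~ P *)
Definition symmetrized (P : law) (x : V) : law :=
  half_mixture P (distribution P (reflection x)).

Section central_regions.
Variable D : law -> V -> R.

Definition region (Q : law) (a : R) : set V := [set z | a <= D Q z].

(* Measurability of the region is required for Q(R_a(Q)) to make sense; it is
   automatic when D(. | Q) is Borel. *)
Definition region_levels (Q : law) (b : R) : set R :=
  [set a | [/\ 0 < a <= 1, measurable (region Q a) &
             (b%:E <= Q (region Q a))%E]].

Definition central_region (Q : law) (b : R) : set V :=
  \bigcap_(a in region_levels Q b) region Q a.

Lemma measurable_central_region Q b : measurable (central_region Q b).
Proof.
rewrite /central_region; set A := region_levels Q b.
have [->|/set0P A0] := eqVneq A set0; first by rewrite bigcap_set0.
have supA : has_sup A by split=> //; exists 1 => a [/andP[]].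
have regS a c : a <= c -> region Q c `<=` region Q a.
  by move=> ac z; exact: le_trans.
have [As|As] := pselect (A (sup A)).
  rewrite (_ : \bigcap_(a in A) _ = region Q (sup A)); first by case: As.
  apply/seteqP; split=> [z|z zs a Aa]; first exact.
  by apply: regS zs; exact: (ub_le_sup supA.2).
have /choice[u uP] n : exists a, A a /\ sup A - n.+1%:R^-1 < a.
  by have [|a Aa la] := @sup_adherent _ A n.+1%:R^-1 _ supA; [rewrite invr_gt0|exists a].
rewrite (_ : \bigcap_(a in A) _ = \bigcap_n region Q (u n)).
  by apply: bigcapT_measurable => n; have [[]] := uP n.
apply/seteqP; split=> [z zA n _|z zu a Aa]; first exact: zA (uP n).1.
have lta : a < sup A.
  rewrite lt_neqAle (ub_le_sup supA.2 Aa) andbT.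
  by apply/eqP => aE; apply: As; rewrite -aE.
have [n nP] := ltr_add_invr lta.
apply: regS (zu n I); apply/ltW/(lt_trans _ (uP n).2).
by rewrite ltrBrDr.
Qed.

(* P conditioned on R^b_x; by [mnormalize], P itself if P(R^b_x) = 0, where
   the conditioning is undefined. *)
Definition localized (P : law) (b : R) (x : V) : law :=
  mnormalize (mrestr P (measurable_central_region (symmetrized P x) b)) P.

Definition local_depth (b : R) (x : V) (P : law) : R :=
  D (localized P b x) x.

Definition integrated_local_depth (W : probability (measurableTypeR R) R)
    (B : R) (x : V) (P : law) : R :=
  \int[W]_(b in `]0, B]) local_depth b x P.

End central_regions.

End local_depth.

Record is_level_weight (R : realType) (B : R)
    (W : probability (measurableTypeR R) R) : Prop := IsLevelWeight {
  level_weight_supp : W `]0, B]%classic = 1%E;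
  level_weight_density : exists w : R -> R,
    [/\ measurable_fun setT w,
        forall t, 0 <= w t,
        (exists M, forall t, w t <= M) &
        forall A, measurable A ->
          W A = (\int[@lebesgue_measure R]_(t in A) (w t)%:E)%E] }.

(* Main.v *)
Require Import Defs.
From mathcomp Require Import all_boot all_order all_algebra.
From mathcomp Require Import all_classical all_reals all_analysis.
From mathcomp Require Import measurable_realfun.

Set Implicit Arguments.
Unset Strict Implicit.
Unset Printing Implicit Defensive.

Import Order.TTheory GRing.Theory Num.Theory.
Import numFieldNormedType.Exports.

Local Open Scope classical_set_scope.
Local Open Scope ring_scope.

(** For each fixed level [b] the integrand tends to 0 at infinity by [hLD], and as a depth value it
    lies in [0,1] whatever the point. Since [W] is a probability measure independent of the point,
    dominated convergence with the constant 1 passes the limit under the integral, along any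
    sequence going to infinity; [cvg_at_infty_seq] shows that such sequences suffice. *)

(* Dominated convergence is a statement about sequences; this brings the limit
   at infinity within its reach. *)
Lemma cvg_at_infty_seq (R : realType) (d : nat) (T : topologicalType)
    (f : 'rV[R]_d -> T) (l : T) :
  (forall u : nat -> 'rV[R]_d, u n @[n --> \oo] --> @at_infty R d ->
     f (u n) @[n --> \oo] --> l) ->
  f x @[x --> @at_infty R d] --> l.
Proof.
move=> seqf U lU; apply: contrapT => noU.
(* If [U] fails to capture [f] near infinity, every radius [n] leaves a bad point beyond it; these
   points form a sequence contradicting [seqf]. *)
have /choice[u uP] (n : nat) : exists x, n%:R < enorm x /\ ~ U (f x).
  apply: contrapT => /forallNP nU; apply: noU; exists n%:R => x nx.
  by apply: contrapT => Ux; apply: (nU x).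
have u_infty : u n @[n --> \oo] --> @at_infty R d.
  move=> S [r rS]; apply: filterS (nbhs_infty_gtr r) => n rn.
  by apply: rS; exact: lt_trans rn (uP n).1.
have [n _ nU] := seqf u u_infty U lU.
by apply: (uP n).2; exact: (nU n (leqnn n)).
Qed.

(** A constant is integrable for a finite measure, so it can serve as the dominating function. *)
Lemma bounded_cvg_Rintegral d (T : measurableType d) (R : realType)
    (P : probability T R) (A : set T) (f_ : nat -> T -> R) (f : T -> R) (M : R) :
  measurable A -> (forall n, measurable_fun A (f_ n)) ->
  (forall x, A x -> f_ n x @[n --> \oo] --> f x) ->
  (forall n x, A x -> `|f_ n x| <= M) ->
  \int[P]_(x in A) f_ n x @[n --> \oo] --> \int[P]_(x in A) f x.
Proof.
move=> mA mf_ f_f f_M.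
have mF n : measurable_fun A (EFin \o f_ n) by exact/measurable_EFinP.
have cvgF x : A x -> (EFin \o f_ n) x @[n --> \oo] --> (EFin \o f) x.
  by move=> Ax; apply: cvg_EFin; [exact: nearW|exact: f_f].
have [||||intf _ cvgint] := @dominated_convergence _ _ _ P A mA
  (fun n => EFin \o f_ n) (EFin \o f) (cst M%:E) mF.
- exact: emeasurable_fun_cvg mF cvgF.
- exact: aeW.
- exact: finite_measure_integrable_cst.
- by apply: aeW => x n Ax; rewrite /= lee_fin; exact: f_M.
(* The limit integral is finite, so convergence in the extended reals descends to the reals. *)
by apply: fine_cvg; rewrite fineK//; exact: integrable_fin_num intf.
Qed.

Theorem mainTheorem5 (R : realType) (d : nat)
    (D : probability 'rV[R]_d R -> 'rV[R]_d -> R)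
    (hD : is_depth D)
    (hLD : forall P : probability 'rV[R]_d R, mass_does_not_escape P ->
       forall b : R, 0 < b <= 1 ->
       local_depth D b x P @[x --> @at_infty R d] --> (0 : R)) :
  forall P : probability 'rV[R]_d R, mass_does_not_escape P ->
  (forall x : 'rV[R]_d,
     measurable_fun (`]0, 1]%classic : set R) (fun b : R => local_depth D b x P)) ->
  forall B : R, 0 < B <= 1 ->
  forall W : probability (measurableTypeR R) R, is_level_weight B W ->
  integrated_local_depth D W B x P @[x --> @at_infty R d] --> (0 : R).
Proof.
move=> P Pinfty mLD B /andP[_ B1] W _.
apply: cvg_at_infty_seq => u u_infty.
have <- : \int[W]_(b in `]0, B]) (0 : R) = 0 by rewrite /Rintegral integral0.
(* The bound 1 is the upper end of the range of [D]. *)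
apply: (@bounded_cvg_Rintegral _ _ _ _ _ _ _ 1) => //=.
- move=> n; apply: (measurable_funS _ _ (mLD (u n))) => //.
  by apply: subset_itvl; rewrite bnd_simp.
- move=> b; rewrite in_itv/= => /andP[b0 bB].
  apply: (@cvg_comp _ _ _ u (fun x => local_depth D b x P) _ _ _ u_infty).
  by apply: hLD => //; rewrite b0 (le_trans bB B1).
- move=> n b _; have /andP[D0 D1] := depth_itv hD (localized D P b (u n)) (u n).
  by rewrite ger0_norm.
Qed.
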